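(* Let $\alpha<\gamma$ be probability levels. The alternating minimization algorithm (described in the context) on input $\alpha,\gamma$ terminates in finitely many iterations, returning $\widetilde\nu$ such that $$\min_{(x,T(x))\in\mathcal X_T}\mathbb E_{\alpha-1}[\mathbb T(x)]\ \ge\ \widetilde\nu\ \ge\ \nu^*=\min_{(x,T(x))\in\mathcal X_T}\mathbb E_{\alpha-\gamma}[\mathbb T(x)].$$
   Context: $[n]=\{1,\dots,n\}$. Let $\mathcal X\subseteq\mathbb R^k$ be nonempty and let $Y$ be a discrete random vector in $\mathbb R^m$ having $n$ distinct realizations (atoms) $y_1,\dots,y_n$ with probabilities $p_1,\dots,p_n$ ($p_i>0$, $\sum_ip_i=1$). Let $f:\mathcal X\times\mathbb R^m\to\mathbb R$ be such that for each fixed realization $y$ of $Y$, $f(x,y)$ is linear in $x$. For $x\in\mathcal X$ put $\mathbb T(x)=f(x,Y)$, $T_i(x)=f(x,y_i)$, $T(x)=(T_1(x),\dots,T_n(x))$; $\mathbb T(x)$ takes the values $T_i(x)$ with associated probabilities $p_i$. Let $F(t)=\mathbb P(\mathbb T(x)\le t)$ and $F^{-1}(p)=\inf\{t:F(t)\ge p\}$. Probability levels are numbers in $[0,1]$. The constraints $x\in\mathcal X$ and $T_i(x)=f(x,y_i)$, $i\in[n]$, are represented as $Ax+BT(x)\le c$ with $A\in\mathbb R^{l\times k}$, $B\in\mathbb R^{l\times n}$, $c\in\mathbb R^l$, and $\mathcal X_T=\{(x,T(x)):Ax+BT(x)\le c\}$ is assumed nonempty, closed and convex. Here $\min$ of an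 optimization problem denotes its optimal value. For $0\le\alpha<1$, $\mathbb E_{\alpha-1}[\mathbb T(x)]=\frac1{1-\alpha}\max\{\sum_iT_i(x)w_ip_i:w\in[0,1]^n,\sum_iw_ip_i=1-\alpha\}$. For $0\le\alpha<\gamma\le1$, $\mathbb E_{\alpha-\gamma}[\mathbb T(x)]=\frac1{\gamma-\alpha}\big((1-\alpha)\mathbb E_{\alpha-1}[\mathbb T(x)]-(1-\gamma)\mathbb E_{\gamma-1}[\mathbb T(x)]\big)$ (last term $0$ if $\gamma=1$); equivalently $\frac1{\gamma-\alpha}\int_\alpha^\gamma F^{-1}(p)\,dp$. Let $\mathcal W'=\{w'\in[0,1]^n:\sum_iw'_ip_i=1-\gamma\}$ and, for given $T(x)$, $\mathscr P(x,T(x))=\{(s,\theta)\in\mathbb R\times\mathbb R^n:\theta_i+sp_i\ge p_iT_i(x),\ \theta_i\ge0\ \forall i\in[n]\}$. Subroutine Find-Xt($\bar w$): for a fixed vector $\bar w$, solve $\min_{x,T(x),s,\theta}\frac1{\gamma-\alpha}\big((1-\alpha)s+\sum_i(\theta_i-T_i(x)p_i\bar w_i)\big)$ subject to $(s,\theta)\in\mathscr P(x,T(x))$, $(x,T(x))\in\mathcal X_T$; return its optimal value and the $(x,T(x))$-part of an optimal solution. Subroutine Find-W($x^*,T^*(x^* )$): for fixed $(x^*,T^*(x^* ))\in\mathcal X_T$, solve $\min_{s,\theta,w'}\frac1{\gamma-\alpha}\big((1-\alpha)s+\sum_i\theta_i-\sum_iT^*_i(x^* )p_iw'_i\big)$ subject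 to $(s,\theta)\in\mathscr P(x^*,T^*(x^* ))$, $w'\in\mathcal W'$; return its optimal value and the $w'$-part of an optimal solution. Alternating minimization algorithm. Input: $\alpha<\gamma$. Initialize $w'=0$, $\epsilon=10^{-6}$, $i=0$. Set $(\nu_i,x^*,T^*(x^* ))\leftarrow$ Find-Xt($w'$) and $(\nu_{i+1},w'^* )\leftarrow$ Find-W($x^*,T^*(x^* )$). While $|\nu_{i+1}-\nu_i|>\epsilon$: set $i\leftarrow i+2$, $(\nu_i,x^*,T^*(x^* ))\leftarrow$ Find-Xt($w'^*$), $(\nu_{i+1},w'^* )\leftarrow$ Find-W($x^*,T^*(x^* )$). When the loop stops, return $\widetilde\nu=\nu_i$.
   Formalization: If the loop never runs and 0<|ν_1−ν_0|≤10^-6, both bounds can fail and are claimed only up to 10^-6; otherwise they are exact. That the subroutines have optimal solutions is claimed only if ν*>−∞, since Find-Xt may otherwise be unbounded; no infinite run is shown in all cases. *)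

(* Defs.v *)
From HB Require Import structures.
From mathcomp Require Import all_boot all_order all_algebra.
From mathcomp Require Import all_classical all_reals all_analysis.

Set Implicit Arguments.
Unset Strict Implicit.
Unset Printing Implicit Defensive.

Import Order.TTheory GRing.Theory Num.Theory.
Import numFieldNormedType.Exports.

Local Open Scope classical_set_scope.
Local Open Scope ring_scope.

(* Vectors are column vectors; the coordinates of
   v : 'cV[R]_n are the v i 0.  The law of the random vector is carried by its
   atoms y_i and their probabilities p i. *)

Section RiskMeasures.
Context {R : realType} {n : nat}.
Implicit Types (p : 'I_n -> R) (a g q : R) (t w : 'cV[R]_n).

(* {w in [0,1]^n : sum_i w_i p_i = q}; the set W' is [weights p (1 - g)]. *)
Definition weights p q : set 'cV[R]_n :=
  [set w | (forall i, 0 <= w i 0 <= 1) /\ \sum_(i < n) w i 0 * p i = q].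

(* E_{a-1} of the variable with values t_i and probabilities p i.  The set is
   nonempty and bounded when 0 <= 1 - a <= 1 (and its sup is then a max).  At
   a = 1 the junk value is 0, since 0^-1 = 0. *)
Definition tail_mean p a t : R :=
  (1 - a)^-1 *
  sup [set \sum_(i < n) t i 0 * w i 0 * p i | w in weights p (1 - a)].

Definition range_mean p a g t : R :=
  (g - a)^-1 * ((1 - a) * tail_mean p a t - (1 - g) * tail_mean p g t).

Definition cvar_feasible p t : set (R * 'cV[R]_n) :=
  [set z : R * 'cV[R]_n | forall i,
    p i * t i 0 <= z.2 i 0 + z.1 * p i /\ 0 <= z.2 i 0].

(* Common objective of both subproblems. *)
Definition am_objective p a g t (s : R) (theta w : 'cV[R]_n) : R :=
  (g - a)^-1 *
  ((1 - a) * s + \sum_(i < n) (theta i 0 - t i 0 * p i * w i 0)).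

End RiskMeasures.

Definition minimizes {R : realType} {Z : Type} (D : set Z) (obj : Z -> R)
    (z : Z) : Prop :=
  D z /\ forall z', D z' -> obj z <= obj z'.

Definition polyhedron {R : realType} {l k n : nat} (A : 'M[R]_(l, k))
    (B : 'M[R]_(l, n)) (c : 'cV[R]_l) : set ('cV[R]_k * 'cV[R]_n) :=
  [set z | forall j, (A *m z.1 + B *m z.2) j 0 <= c j 0].

(* Optimal value in the extended reals: -oo when unbounded below. *)
Definition opt_value {R : realType} {Z : Type} (D : set Z) (obj : Z -> R) :
    \bar R :=
  ereal_inf [set (obj z)%:E | z in D].

Section AlternatingMinimization.
Context {R : realType} {k n : nat}.
Variables (p : 'I_n -> R) (a g : R) (XT : set ('cV[R]_k * 'cV[R]_n)).

(* The subroutines are nondeterministic: any optimal solution may be returned,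
   and nothing is returned when no optimal solution exists. *)
Definition find_xt (w : 'cV[R]_n) (nu : R) (z : 'cV[R]_k * 'cV[R]_n) : Prop :=
  exists s theta,
    minimizes
      [set u : ('cV[R]_k * 'cV[R]_n) * (R * 'cV[R]_n) |
        cvar_feasible p u.1.2 u.2 /\ XT u.1]
      (fun u => am_objective p a g u.1.2 u.2.1 u.2.2 w)
      (z, (s, theta))
    /\ nu = am_objective p a g z.2 s theta w.

Definition find_w (z : 'cV[R]_k * 'cV[R]_n) (nu : R) (w : 'cV[R]_n) : Prop :=
  exists s theta,
    minimizes
      [set u : (R * 'cV[R]_n) * 'cV[R]_n |
        cvar_feasible p z.2 u.1 /\ weights p (1 - g) u.2]
      (fun u => am_objective p a g z.2 u.1.1 u.1.2 u.2)
      ((s, theta), w)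
    /\ nu = am_objective p a g z.2 s theta w.

(* Program variables when the loop test is evaluated: [nu_even] is nu_i,
   [nu_odd] is nu_{i+1}, with i even. *)
Record am_state : Type := AmState {
  nu_even : R;
  cur_xt : 'cV[R]_k * 'cV[R]_n;
  nu_odd : R;
  cur_w : 'cV[R]_n }.

Definition am_pass (w : 'cV[R]_n) (st : am_state) : Prop :=
  find_xt w (nu_even st) (cur_xt st) /\
  find_w (cur_xt st) (nu_odd st) (cur_w st).

Definition am_eps : R := 10%:R ^- 6.

Definition am_init (st : am_state) : Prop := am_pass 0 st.

Definition am_continue (st : am_state) : bool :=
  am_eps < `|nu_odd st - nu_even st|.

Definition am_step (st st' : am_state) : Prop :=
  am_continue st /\ am_pass (cur_w st) st'.

(* [am_reached N st]: some execution is in state [st] after N runs of the loop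
   body, i.e. with i = 2 N. *)
Inductive am_reached : nat -> am_state -> Prop :=
| AmReached0 st : am_init st -> am_reached 0 st
| AmReachedS N st st' :
    am_reached N st -> am_step st st' -> am_reached N.+1 st'.

(* Some execution stops after N runs of the loop body, in state [st]; the value
   it returns is [nu_even st]. *)
Definition am_stops (N : nat) (st : am_state) : Prop :=
  am_reached N st /\ ~~ am_continue st.

End AlternatingMinimization.

(* Main.v *)
Require Import Defs.
From HB Require Import structures.
From mathcomp Require Import all_boot all_order all_algebra.
From mathcomp Require Import all_classical all_reals all_analysis.
From mathcomp Require Import ring lra.

Set Implicit Arguments.
Unset Strict Implicit.
Unset Printing Implicit Defensive.

Import Order.TTheory GRing.Theory Num.Theory.
Import numFieldNormedType.Exports.

Local Open Scope classical_set_scope.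
Local Open Scope ring_scope.

(** Write S_q(t) for the largest value of sum_i t_i w_i p_i over the weights
    w in [0,1]^n of total mass q.  The constraints on (s, theta) are the linear
    programming dual of this maximum, so that, for fixed t, minimizing over
    (s, theta) replaces (1 - alpha) s + sum_i theta_i by S_(1-alpha)(t)
    ([tail_sum_attained]).  Hence Find-Xt minimizes over XT the function
      (gamma - alpha)^-1 (S_(1-alpha)(t) - sum_i t_i w_i p_i)
    called [xt_value] below, and Find-W returns the minimum of the same
    expression over w in W', which is
    (gamma - alpha)^-1 (S_(1-alpha)(t) - S_(1-gamma)(t)), the range mean at the
    current point.  Two consequences give the bounds.  Every odd value is the
    range mean at a feasible point, hence at least nu_star.  As alternating
    minimization never increases the objective once w lies in W', the values
    decrease from nu_1 on, and nu_1 is at most the minimal tail mean: the first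
    point minimizes the tail mean, since w = 0 there, and a range mean is at
    most the corresponding tail mean.  Only nu_0 may lie below nu_1, because
    0 is not in W' unless gamma = 1; it is compared with nu_1 through the
    stopping test.

    Termination.  While the loop runs, each pass lowers the values by more than
    epsilon, so they would tend to -oo.  Boundedness of the objective on XT is
    not available, since nu_star may be -oo.  It is replaced by a property of
    linear programs ([lp_finite_minimizers]): one finite family of feasible
    points contains a minimizer of every linear functional that is bounded
    below on the polyhedron.  Every value that Find-Xt returns for a w in W' is
    therefore [xt_value] at one of finitely many points, and so at least the
    range mean at that point, which gives a lower bound independent of w
    ([find_xt_lower_bound]).  The same family provides the minimizers that show
    that no execution is stuck when nu_star is finite ([am_not_stuck]). *)

(** * Finite families of minimizers for linear programs *)

Section LinearPrograms.
Context {R : realType} {V : lmodType R} {J : finType}.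
Variables (h : J -> V -> R) (b : J -> R).
Hypothesis h_lin : forall j, scalar (h j).

Let P : set V := [set z | forall j, h j z <= b j].
Let active (z : V) : {set J} := [set j | h j z == b j].

Let scalarD_scale (phi : V -> R) r u v : scalar phi ->
  phi (v + r *: u) = phi v + r * phi u.
Proof. by move=> lphi; rewrite addrC lphi addrC. Qed.

Let scalarB (phi : V -> R) u v : scalar phi -> phi (u - v) = phi u - phi v.
Proof. by move=> lphi; rewrite -scaleN1r scalarD_scale// mulN1r. Qed.

(** A ray from a feasible point that keeps the active constraints active and
    along which some constraint increases stops at the first constraint that
    becomes tight there. *)
Lemma active_ray (z d : V) j0 : P z -> 0 < h j0 d ->
    (forall j, j \in active z -> h j d = 0) ->
  exists r, [/\ 0 <= r, P (z + r *: d) &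
                active z \proper active (z + r *: d)].
Proof.
move=> Pz hd0 act0.
pose r j := (b j - h j z) / h j d.
have [j1 hd1 rmin] := @arg_minP _ _ _ j0 (fun j => 0 < h j d) r hd0.
have r0 : 0 <= r j1 by rewrite divr_ge0 ?subr_ge0 ?(ltW hd1) ?Pz.
have Eh j : h j (z + r j1 *: d) = h j z + r j1 * h j d.
  exact: scalarD_scale.
exists (r j1); split=> //.
- move=> j; rewrite Eh; have [hd|hd] := ltP 0 (h j d).
    by rewrite addrC -lerBrDr -ler_pdivlMr//; exact: rmin.
  by rewrite (le_trans _ (Pz j))// gerDl mulr_ge0_le0.
- apply/properP; split.
    apply/fintype.subsetP => j jz; rewrite inE Eh act0// mulr0 addr0.
    by move: jz; rewrite inE.
  exists j1.
    by rewrite inE Eh (divfK (lt0r_neq0 hd1)) addrC subrK.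
  by apply/negP => /act0 hd; move: hd1; rewrite hd ltxx.
Qed.

(** One point v I is chosen on each nonempty face, the face where the
    constraints in I are tight.  Given a feasible z with active set I, either
    v I does at least as well as z, or the functional decreases along the
    direction from v I to z.  That direction keeps the constraints in I tight,
    and since the functional is bounded below, the ray leaves the polyhedron;
    at the exit point the value is no larger and the active set is strictly
    larger.  Iterating ends at a chosen point.  The family does not depend on
    the functional, which is what gives bounds uniform in it. *)
Lemma lp_finite_minimizers : P !=set0 ->
  exists v : {set J} -> V, (forall I, P (v I)) /\
    forall (phi : V -> R) K, scalar phi -> (forall z, P z -> K <= phi z) ->
      exists I, forall z, P z -> phi (v I) <= phi z.
Proof.
move=> [z0 Pz0].
pose face (I : {set J}) : set V :=
  [set z | P z /\ forall j, j \in I -> h j z = b j].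
(* Empty faces receive the default feasible point z0. *)
pose v I := xget z0 (face I).
have Pv I : P (v I) by rewrite /v; case: xgetP => [z _ []|].
have v_active z j : P z -> j \in active z -> h j (v (active z)) = b j.
  move=> Pz jz; have : face (active z) (v (active z)).
    apply: (@xgetPex _ z0); exists z; split=> // i.
    by rewrite inE => /eqP.
  by case=> _; apply.
exists v; split=> // phi K lphi phiK.
suff below z : P z -> exists I, phi (v I) <= phi z.
  have [I _ Imin] :=
    @arg_minP _ _ _ (finset.set0 : {set J}) xpredT (phi \o v) isT.
  by exists I => z /below[I']; apply: le_trans; exact: Imin.
have [m] := ubnP #|~: active z|; elim: m z => // m IHm z.
rewrite ltnS => zm Pz.
have [?|lt_z] := leP (phi (v (active z))) (phi z); first by exists (active z).
pose d := z - v (active z).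
have phid : phi d < 0 by rewrite scalarB// subr_lt0.
have d_active j : j \in active z -> h j d = 0.
  move=> jz; rewrite scalarB// v_active//.
  by move: jz; rewrite inE => /eqP ->; rewrite subrr.
have [/existsP[j0 hd0]|] := boolP [exists j, 0 < h j d].
  have [r [r0 Pz' lt_act]] := active_ray Pz hd0 d_active.
  have [||I phiI] := IHm (z + r *: d) => //.
    by apply: leq_trans zm; rewrite proper_card// properC.
  exists I; apply: le_trans phiI _.
  by rewrite scalarD_scale// gerDl mulr_ge0_le0// ltW.
rewrite negb_exists => /forallP hd.
(* If no constraint stops the ray, this step brings phi down to K - 1. *)
pose r := (phi z - K + 1) / - phi d.
have r0 : 0 <= r.
  rewrite divr_ge0 ?oppr_ge0 ?(ltW phid)// addr_ge0//.
  by rewrite subr_ge0 phiK.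
have : K <= phi (z + r *: d).
  apply: phiK => j; rewrite scalarD_scale// (le_trans _ (Pz j))//.
  by rewrite gerDl mulr_ge0_le0// leNgt hd.
rewrite scalarD_scale// /r invrN mulrN mulNr divfK ?lt_eqF//.
lra.
Qed.

End LinearPrograms.

(** * Tail sums and their dual program *)

Section TailSums.
Context {R : realType} {n : nat}.
Variable p : 'I_n -> R.
Hypothesis p_gt0 : forall i, 0 < p i.
Hypothesis p_sum1 : \sum_(i < n) p i = 1.
Implicit Types (q a g s : R) (t w theta : 'cV[R]_n) (z : R * 'cV[R]_n).

(** [tail_mean] without its normalization by the mass q, which avoids the
    division by zero at level 1. *)
Definition tail_sum q t : R :=
  sup [set \sum_(i < n) t i 0 * w i 0 * p i | w in weights p q].

Lemma cvar_weak_duality q t z w : cvar_feasible p t z -> weights p q w ->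
  \sum_(i < n) t i 0 * w i 0 * p i <= q * z.1 + \sum_(i < n) z.2 i 0.
Proof.
move=> feas [w01 <-]; rewrite mulr_suml -big_split/=.
apply: ler_sum => i _; have [c1 c2] := feas i.
have /andP[w0 w1] := w01 i.
have : w i 0 * (p i * t i 0) <= w i 0 * (z.2 i 0 + z.1 * p i).
  by rewrite ler_wpM2l.
have : w i 0 * z.2 i 0 <= z.2 i 0 by rewrite ler_piMl.
lra.
Qed.

(** The largest atom value whose upper tail still has mass at least q is such
    an s: the tail strictly above it is the upper tail of the next larger
    value, hence has mass less than q, or is empty. *)
Lemma quantile_exists q t : 0 <= q <= 1 ->
  exists s, \sum_(i < n | s < t i 0) p i <= q <= \sum_(i < n | s <= t i 0) p i.
Proof.
move=> /andP[q0 q1].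
have [i0 _] : exists i0 : 'I_n, True.
  apply: contrapT => /forallNP none; have := oner_neq0 R.
  by rewrite -p_sum1 big1 ?eqxx// => i; case: (none i).
pose upper i := q <= \sum_(j < n | t i 0 <= t j 0) p j.
have [im _ im_min] := @arg_minP _ _ _ i0 xpredT (fun i => t i 0) isT.
have upper_im : upper im.
  rewrite /upper (eq_bigl xpredT) ?p_sum1// => j; exact: im_min.
have [i1 upper_i1 i1_max] := @arg_maxP _ _ _ im upper (fun i => t i 0) upper_im.
exists (t i1 0); rewrite [X in _ && X]upper_i1 andbT leNgt; apply/negP => lt_q.
have [i2 lt_i2] : exists i, t i1 0 < t i 0.
  apply: contrapT => /forallNP none; move: lt_q.
  by rewrite big_pred0 ?ltNge ?q0// => i; apply/negP/none.
have [i3 lt_i3 i3_min] :=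
  @arg_minP _ _ _ i2 (fun i => t i1 0 < t i 0) (fun i => t i 0) lt_i2.
have : t i3 0 <= t i1 0.
  apply: i1_max; rewrite /upper (eq_bigl (fun i => t i1 0 < t i 0)) ?ltW// => i.
  by apply/idP/idP; [exact: lt_le_trans | exact: i3_min].
by rewrite leNgt lt_i3.
Qed.

(** Complementary slackness dictates the pair: s is a quantile, theta_i is the
    excess p_i (t_i - s)^+, and w is 1 above s, 0 below s, and on the level s
    the constant fraction r that completes the mass to q. *)
Lemma cvar_strong_duality q t : 0 <= q <= 1 -> exists z w,
  [/\ cvar_feasible p t z, weights p q w &
      q * z.1 + \sum_(i < n) z.2 i 0 = \sum_(i < n) t i 0 * w i 0 * p i].
Proof.
move=> /(quantile_exists t)[s /andP[above_q q_upper]].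
pose above := \sum_(i < n | s < t i 0) p i.
pose level := \sum_(i < n | t i 0 == s) p i.
have upperE : \sum_(i < n | s <= t i 0) p i = above + level.
  rewrite (bigID (fun i => s < t i 0))/=; congr (_ + _); apply: eq_bigl => i.
    by rewrite andb_idl// => /ltW.
  by rewrite -leNgt andbC -eq_le.
have level0 : 0 <= level by apply: sumr_ge0 => i _; exact: ltW.
pose r := (q - above) / level.
(* If the level s had no mass, both bounds on q would coincide, and the
   quotient r = 0 would still satisfy this. *)
have r_level : r * level = q - above.
  have [level_eq0|level_neq0] := eqVneq level 0; last by rewrite divfK.
  move: q_upper above_q; rewrite upperE level_eq0 mulr0 addr0 -/above.
  by lra.
have r01 : 0 <= r <= 1.
  apply/andP; split; first by rewrite divr_ge0// subr_ge0.
  have [level_eq0|level_neq0] := eqVneq level 0.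
    by rewrite /r level_eq0 invr0 mulr0.
  rewrite ler_pdivrMr ?lt_def ?level_neq0// mul1r lerBlDl -upperE//.
pose w : 'cV[R]_n := \col_i (if s < t i 0 then 1 else
  if t i 0 == s then r else 0).
pose theta : 'cV[R]_n := \col_i (if s < t i 0 then p i * (t i 0 - s) else 0).
have wE : \sum_(i < n) w i 0 * p i = q.
  have -> : q = above + r * level by rewrite r_level addrC subrK.
  rewrite (bigID (fun i => s < t i 0))/=; congr (_ + _).
    by apply: eq_bigr => i lt_s; rewrite mxE lt_s mul1r.
  rewrite (bigID (fun i => t i 0 == s))/= [X in _ + X]big1 ?addr0.
    rewrite /level mulr_sumr; apply: eq_big => i.
      by rewrite andb_idl// => /eqP ->; rewrite ltxx.
    by move=> /andP[/negbTE n_s e_s]; rewrite mxE n_s e_s.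
  by move=> i /andP[/negbTE n_s /negbTE ne_s]; rewrite mxE n_s ne_s mul0r.
exists (s, theta), w; split.
- move=> i; rewrite /= !mxE; case: ltP => [lt_s|le_s].
    have := p_gt0 i; have : 0 <= p i * (t i 0 - s).
      by apply: mulr_ge0; rewrite ?subr_ge0 ltW.
    by split; [lra|].
  by split=> //; rewrite add0r mulrC ler_wpM2r// ltW.
- split=> // i; rewrite mxE; case: ifP => _; first by rewrite ler01 lexx.
  by case: ifP => _; rewrite ?lexx ?ler01.
- rewrite /= -{1}wE mulr_suml -big_split/=; apply: eq_bigr => i _.
  rewrite !mxE; case: ifP => _; first by lra.
  by case: eqP => [->|_]; lra.
Qed.

Lemma tail_sum_ge q t w : 0 <= q <= 1 -> weights p q w ->
  \sum_(i < n) t i 0 * w i 0 * p i <= tail_sum q t.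
Proof.
move=> /(cvar_strong_duality t)[z [_ [feas _ _]]] ww.
apply: ub_le_sup; last by exists w.
by exists (q * z.1 + \sum_(i < n) z.2 i 0) => _ [w' ww' <-];
  exact: cvar_weak_duality.
Qed.

Lemma tail_sum_le q t K : 0 <= q <= 1 ->
  (forall w, weights p q w -> \sum_(i < n) t i 0 * w i 0 * p i <= K) ->
  tail_sum q t <= K.
Proof.
move=> /(cvar_strong_duality t)[_ [w [_ ww _]]] ub.
by apply: ge_sup => [|_ [w' ww' <-]]; [eexists; exists w | exact: ub].
Qed.

Lemma tail_sum_attained q t : 0 <= q <= 1 -> exists z w,
  [/\ cvar_feasible p t z, weights p q w,
      q * z.1 + \sum_(i < n) z.2 i 0 = tail_sum q t &
      \sum_(i < n) t i 0 * w i 0 * p i = tail_sum q t].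
Proof.
move=> q01; have [z [w [feas ww E]]] := cvar_strong_duality t q01.
have Etail : \sum_(i < n) t i 0 * w i 0 * p i = tail_sum q t.
  apply/eqP; rewrite eq_le tail_sum_ge//= -E tail_sum_le// => w' ww'.
  exact: cvar_weak_duality.
by exists z, w; rewrite E.
Qed.

Lemma tail_sum_le_cvar q t z : 0 <= q <= 1 -> cvar_feasible p t z ->
  tail_sum q t <= q * z.1 + \sum_(i < n) z.2 i 0.
Proof.
by move=> q01 feas; apply: tail_sum_le => // w; exact: cvar_weak_duality.
Qed.

(** With positive probabilities the zero weight is the only one of mass 0. *)
Lemma tail_sum0 t : tail_sum 0 t = 0.
Proof.
have [|z [w [_ [w01 /eqP wq] _ <-]]] := @tail_sum_attained 0 t.
  by rewrite lexx ler01.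
move: wq; rewrite psumr_eq0 => [/allP wp0|i _]; last first.
  by rewrite mulr_ge0 ?(ltW (p_gt0 i))//; have /andP[] := w01 i.
by rewrite big1// => i _; rewrite -mulrA (eqP (wp0 i (mem_index_enum i))) mulr0.
Qed.

(** Scaling the weights by q' / q shows that the average over the upper tail
    of mass q' is at least the one over the larger tail of mass q. *)
Lemma tail_sum_scale q q' t : 0 <= q' <= q -> 0 < q <= 1 ->
  q' / q * tail_sum q t <= tail_sum q' t.
Proof.
move=> /andP[q'0 q'q] /andP[q0 q1].
have [|z [w [_ [w01 wq] _ <-]]] := @tail_sum_attained q t; first by rewrite ltW.
have r0 : 0 <= q' / q by rewrite divr_ge0// ltW.
have -> : q' / q * \sum_(i < n) t i 0 * w i 0 * p i =
    \sum_(i < n) t i 0 * ((q' / q) *: w) i 0 * p i.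
  rewrite mulr_sumr; apply: eq_bigr => i _; rewrite mxE; lra.
apply: tail_sum_ge; first by rewrite q'0 (le_trans q'q).
split=> [i|].
  have /andP[w0 w1] := w01 i; rewrite mxE mulr_ge0//= mulr_ile1//.
  by rewrite ler_pdivrMr// mul1r.
rewrite (eq_bigr (fun i => q' / q * (w i 0 * p i))) => [|i _].
  by rewrite -mulr_sumr wq divfK// gt_eqF.
by rewrite mxE mulrA.
Qed.

(** At a = 1 the conventional value 0 of [tail_mean] is consistent with the
    tail sum of mass 0. *)
Lemma tail_meanE a t : (1 - a) * tail_mean p a t = tail_sum (1 - a) t.
Proof.
rewrite /tail_mean -/(tail_sum _ _).
have [->|q0] := eqVneq (1 - a) 0; first by rewrite mul0r tail_sum0.
by rewrite mulVKf.
Qed.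

Lemma range_meanE a g t : range_mean p a g t =
  (g - a)^-1 * (tail_sum (1 - a) t - tail_sum (1 - g) t).
Proof. by rewrite /range_mean !tail_meanE. Qed.

(** After clearing denominators this says that (1 - g) times the tail mean at
    level a is at most the tail sum of mass 1 - g, which is [tail_sum_scale]. *)
Lemma range_mean_le_tail_mean a g t : 0 <= a -> a < g -> g <= 1 ->
  range_mean p a g t <= tail_mean p a t.
Proof.
move=> a0 ag g1; rewrite range_meanE mulrC ler_pdivrMr ?subr_gt0//.
have a1 : 0 < 1 - a by rewrite subr_gt0 (lt_le_trans ag).
rewrite mulrBr -subr_ge0 (_ : _ - _ =
  tail_sum (1 - g) t - (1 - g) * tail_mean p a t); last first.
  by rewrite -tail_meanE; lra.
rewrite subr_ge0 -[tail_mean p a t](mulKf (lt0r_neq0 a1)) tail_meanE mulrA.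
by apply: tail_sum_scale; lra.
Qed.

End TailSums.

(** * The two subproblems and the descent of the values *)

Section AlternatingMinimization.
Context {R : realType} {k n l : nat}.
Variable p : 'I_n -> R.
Hypothesis p_gt0 : forall i, 0 < p i.
Hypothesis p_sum1 : \sum_(i < n) p i = 1.
Variables a g : R.
Hypotheses (a_ge0 : 0 <= a) (a_lt_g : a < g) (g_le1 : g <= 1).
Implicit Types (t w theta : 'cV[R]_n) (z : 'cV[R]_k * 'cV[R]_n) (nu : R).
Implicit Type st : @am_state R k n.

Let scale_gt0 : 0 < (g - a)^-1.
Proof. by rewrite invr_gt0 subr_gt0. Qed.

Let mass_a : 0 <= 1 - a <= 1.
Proof. by move: a_ge0 a_lt_g g_le1 => *; apply/andP; split; lra. Qed.

Let mass_g : 0 <= 1 - g <= 1.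
Proof. by move: a_ge0 a_lt_g g_le1 => *; apply/andP; split; lra. Qed.

(** The common objective after minimization over (s, theta). *)
Definition xt_value w t : R :=
  (g - a)^-1 * (tail_sum p (1 - a) t - \sum_(i < n) t i 0 * w i 0 * p i).

Lemma am_objectiveE t s theta w : am_objective p a g t s theta w =
  (g - a)^-1 * (((1 - a) * s + \sum_(i < n) theta i 0) -
                \sum_(i < n) t i 0 * w i 0 * p i).
Proof.
rewrite /am_objective sumrB addrA; congr (_ * (_ - _)).
by apply: eq_bigr => i _; rewrite mulrAC.
Qed.

Lemma xt_value_le_objective t s theta w : cvar_feasible p t (s, theta) ->
  xt_value w t <= am_objective p a g t s theta w.
Proof.
move=> feas; rewrite am_objectiveE ler_pM2l// lerB//.
exact: (tail_sum_le_cvar p_gt0 p_sum1 mass_a feas).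
Qed.

(** One pair (s, theta) is optimal for all w simultaneously, because the
    objective separates these variables from w. *)
Lemma xt_value_attained t : exists s theta, cvar_feasible p t (s, theta) /\
  forall w, am_objective p a g t s theta w = xt_value w t.
Proof.
have [[s theta] [_ [feas _ E _]]] := tail_sum_attained p_gt0 p_sum1 t mass_a.
by exists s, theta; split=> // w; rewrite am_objectiveE E.
Qed.

Lemma range_mean_le_xt_value w t : weights p (1 - g) w ->
  range_mean p a g t <= xt_value w t.
Proof.
move=> ww; rewrite range_meanE// ler_pM2l// lerB//.
exact: tail_sum_ge.
Qed.

(** With w = 0 the first call of Find-Xt minimizes a positive multiple of the
    tail mean. *)
Lemma xt_value0 t : xt_value 0 t = (g - a)^-1 * tail_sum p (1 - a) t.
Proof.
by rewrite /xt_value big1 ?subr0// => i _; rewrite mxE mulr0 mul0r.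
Qed.

Section Subroutines.
Variable XT : set ('cV[R]_k * 'cV[R]_n).

Lemma find_xt_spec w nu z : find_xt p a g XT w nu z ->
  [/\ XT z, nu = xt_value w z.2 & forall z', XT z' -> nu <= xt_value w z'.2].
Proof.
move=> [s [theta [[[/= feas XTz] min_nu] ->]]].
have le_nu z' : XT z' -> am_objective p a g z.2 s theta w <= xt_value w z'.2.
  move=> XTz'; have [s' [theta' [feas' <-]]] := xt_value_attained z'.2.
  exact: (min_nu (z', (s', theta'))).
split=> //; apply/eqP; rewrite eq_le le_nu//=.
exact: xt_value_le_objective.
Qed.

Lemma find_w_spec z nu w : find_w p a g z nu w ->
  [/\ weights p (1 - g) w, nu = range_mean p a g z.2 & nu = xt_value w z.2].
Proof.
move=> [s [theta [[[/= feas ww] min_nu] ->]]].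
have le_nu : am_objective p a g z.2 s theta w <= range_mean p a g z.2.
  have [s' [theta' [feas' E']]] := xt_value_attained z.2.
  have [_ [w' [_ ww' _ Ew']]] := tail_sum_attained p_gt0 p_sum1 z.2 mass_g.
  apply: le_trans (min_nu ((s', theta'), w') (conj feas' ww')) _ => /=.
  by rewrite E' range_meanE// /xt_value Ew'.
have ge_nu := xt_value_le_objective w feas.
have ge_val := range_mean_le_xt_value z.2 ww.
by split=> //; apply/eqP; rewrite eq_le; apply/andP; split; lra.
Qed.

Lemma find_w_exists z : exists nu w, find_w p a g z nu w.
Proof.
have [s [theta [feas E]]] := xt_value_attained z.2.
have [_ [w [_ ww _ Ew]]] := tail_sum_attained p_gt0 p_sum1 z.2 mass_g.
exists (xt_value w z.2), w, s, theta; rewrite E; split=> //.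
split=> // -[[s' theta'] w'] [/= feas' ww'].
rewrite E; apply: le_trans (xt_value_le_objective w' feas').
rewrite ler_pM2l// lerB// Ew; exact: tail_sum_ge.
Qed.

Lemma am_pass_weights w st : weights p (1 - g) w -> am_pass p a g XT w st ->
  nu_odd st <= nu_even st.
Proof.
move=> ww [/find_xt_spec[_ -> _] /find_w_spec[_ -> _]].
exact: range_mean_le_xt_value.
Qed.

(** The point z from which w was computed competes in the next call of
    Find-Xt. *)
Lemma am_even_le_previous_odd w z nu nu' z' : find_w p a g z nu w -> XT z ->
  find_xt p a g XT w nu' z' -> nu' <= nu.
Proof. by move=> /find_w_spec[_ _ ->] XTz /find_xt_spec[_ _]; apply. Qed.

(** The invariant.  The two bounds on the even value start only after the first
    pass of the loop, since the initial w = 0 need not be in W'. *)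
Lemma am_reached_spec N st : am_reached p a g XT N st ->
  [/\ XT (cur_xt st),
      find_w p a g (cur_xt st) (nu_odd st) (cur_w st),
      (forall z, XT z -> nu_odd st <= tail_mean p a z.2) &
      (0 < N)%N -> nu_odd st <= nu_even st /\
        forall z, XT z -> nu_even st <= tail_mean p a z.2].
Proof.
elim=> {N st} [st [/find_xt_spec[XTx even min_x] fw]|].
  split=> // z XTz; have [_ -> _] := find_w_spec fw.
  apply: le_trans (range_mean_le_tail_mean p_gt0 p_sum1 _ a_ge0 a_lt_g g_le1) _.
  rewrite ler_wpM2l ?invr_ge0; [by []|by case/andP: mass_a|].
  by have := min_x z XTz; rewrite even !xt_value0 ler_pM2l.
move=> N st st' _ [XTx fw odd_tail _] [_ pass].
have [ww _ _] := find_w_spec fw.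
have odd_even := am_pass_weights ww pass.
case: pass => fx' fw'; have [XTx' _ _] := find_xt_spec fx'.
have even_tail z : XT z -> nu_even st' <= tail_mean p a z.2.
  by move=> /odd_tail; apply: le_trans (am_even_le_previous_odd fw XTx fx').
by split=> // z XTz; apply: le_trans odd_even (even_tail z XTz).
Qed.

(** Each odd value is at least the following even one, which exceeds the
    following odd one by more than epsilon as long as the loop goes on. *)
Lemma am_infinite_run_unbounded (st : nat -> am_state) K :
    am_init p a g XT (st 0%N) ->
    (forall j, am_step p a g XT (st j) (st j.+1)) ->
  exists j, nu_even (st j.+1) < K.
Proof.
move=> init step.
have reached j : am_reached p a g XT j (st j).
  by elim: j => [|j IHj]; [exact: AmReached0 | exact: AmReachedS (step j)].
have odd_drop j : nu_odd (st j) <= nu_odd (st 0%N) - j%:R * am_eps.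
  elim: j => [|j IHj]; first by rewrite mul0r subr0.
  have [XTx fw _ _] := am_reached_spec (reached j).
  have [_ _ _ /(_ isT)[odd_even _]] := am_reached_spec (reached j.+1).
  have [_ [fx _]] := step j.
  have even_odd := am_even_le_previous_odd fw XTx fx.
  have [+ _] := step j.+1; rewrite /am_continue distrC ger0_norm ?subr_ge0//.
  rewrite -natr1; lra.
have eps0 : 0 < am_eps :> R by rewrite invr_gt0 exprn_gt0.
pose c := (nu_odd (st 0%N) - K) / am_eps.
exists (Num.truncn c).+1.
have [XTx fw _ _] := am_reached_spec (reached (Num.truncn c).+1).
have [_ [fx _]] := step (Num.truncn c).+1.
apply: le_lt_trans (am_even_le_previous_odd fw XTx fx) _.
apply: le_lt_trans (odd_drop _) _.
by rewrite ltrBlDr addrC -ltrBlDr -ltr_pdivrMr// truncnS_gt.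
Qed.

End Subroutines.

(** * Termination and bounds over a polyhedron *)

Section Polyhedral.
Variables (A : 'M[R]_(l, k)) (B : 'M[R]_(l, n)) (c : 'cV[R]_l).
Let XT := polyhedron A B c.

Let program_space : lmodType R :=
  (('cV[R]_k * 'cV[R]_n) * (R * 'cV[R]_n))%type.

Let objective w (u : program_space) : R :=
  am_objective p a g u.1.2 u.2.1 u.2.2 w.

Let objective_scalar w : scalar (objective w).
Proof.
move=> r [[x t] [s theta]] [[x' t'] [s' theta']].
rewrite /objective !am_objectiveE/=.
have -> : \sum_(i < n) (r *: theta + theta') i 0 =
    r * \sum_(i < n) theta i 0 + \sum_(i < n) theta' i 0.
  by rewrite mulr_sumr -big_split/=; apply: eq_bigr => i _; rewrite !mxE.
have -> : \sum_(i < n) (r *: t + t') i 0 * w i 0 * p i =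
    r * \sum_(i < n) t i 0 * w i 0 * p i +
    \sum_(i < n) t' i 0 * w i 0 * p i.
  rewrite mulr_sumr -big_split/=; apply: eq_bigr => i _; rewrite !mxE.
  by rewrite !mulrDl !mulrA.
rewrite /GRing.scale/=; ring.
Qed.

Let index : finType := ('I_l + ('I_n + 'I_n))%type.

Let lhs (j : index) (u : program_space) : R :=
  match j with
  | inl j => (A *m u.1.1 + B *m u.1.2) j 0
  | inr (inl i) => p i * u.1.2 i 0 - (u.2.2 i 0 + u.2.1 * p i)
  | inr (inr i) => - u.2.2 i 0
  end.

Let rhs (j : index) : R := if j is inl j then c j 0 else 0.

Let lhs_scalar j : scalar (lhs j).
Proof.
move=> r [[x t] [s theta]] [[x' t'] [s' theta']].
case: j => [j|[i|i]]/=.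
- rewrite !mulmxDr -!scalemxAr addrACA -scalerDr.
  by rewrite [LHS]mxE [X in X + _]mxE.
- rewrite !mxE /GRing.scale/=; ring.
- rewrite !mxE; ring.
Qed.

Let lp_feasibleE (u : program_space) :
  (forall j, lhs j u <= rhs j) <-> cvar_feasible p u.1.2 u.2 /\ XT u.1.
Proof.
split=> [feas|[feas XTu] [j|[i|i]]].
- split=> [i|j]; last exact: (feas (inl j)).
  have := feas (inr (inl i)); have := feas (inr (inr i)) => /=.
  by rewrite oppr_le0 subr_le0.
- exact: XTu.
- by rewrite /= subr_le0; have [] := feas i.
- by rewrite /= oppr_le0; have [] := feas i.
Qed.

(** Find-Xt is a linear program in (x, t, s, theta) whose constraints do not
    depend on w, so that one finite family serves all w. *)
Lemma find_xt_candidates : XT !=set0 ->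
  exists (T : finType) (v : T -> 'cV[R]_k * 'cV[R]_n),
    (forall i, XT (v i)) /\
    forall w K, (forall z, XT z -> K <= xt_value w z.2) ->
      exists i, find_xt p a g XT w (xt_value w (v i).2) (v i).
Proof.
move=> [z0 XTz0].
have [s0 [theta0 [feas0 _]]] := xt_value_attained z0.2.
have [|u [Pu u_min]] := lp_finite_minimizers (b := rhs) lhs_scalar.
  by exists (z0, (s0, theta0)); apply/lp_feasibleE.
exists {set index}, (fun I => (u I).1); split=> [I|w K lbK].
  by have /lp_feasibleE[] := Pu I.
have [|I minI] := u_min _ K (objective_scalar w).
  move=> z /lp_feasibleE[feas XTz]; apply: le_trans (lbK _ XTz) _.
  by apply: xt_value_le_objective; case: z.2 feas.
have fx : find_xt p a g XT w (objective w (u I)) (u I).1.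
  exists (u I).2.1, (u I).2.2; split=> //; split.
    by have /lp_feasibleE := Pu I; case: (u I) => [[? ?] [? ?]].
  move=> z' Dz'; have /minI : forall j, lhs j z' <= rhs j by apply/lp_feasibleE.
  by case: (u I) => [[? ?] [? ?]].
by exists I; have [_ <- _] := find_xt_spec fx.
Qed.

(** The value found is [xt_value] w at one of the candidates, hence at least
    the range mean there; K is below all these finitely many range means. *)
Lemma find_xt_lower_bound : XT !=set0 -> exists K, forall w nu z,
  weights p (1 - g) w -> find_xt p a g XT w nu z -> K <= nu.
Proof.
move=> /find_xt_candidates[T [v [_ v_min]]].
exists (- \sum_i `|range_mean p a g (v i).2|) => w nu z ww.
move=> /find_xt_spec[XTz -> min_z].
have [i /find_xt_spec[_ _ /(_ z XTz)]] := v_min w _ min_z.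
apply: le_trans; apply: le_trans (range_mean_le_xt_value _ ww).
rewrite lerNl (le_trans (ler_norm _))// normrN.
by rewrite (bigD1 i)//= lerDl sumr_ge0.
Qed.

Lemma am_terminates : XT !=set0 ->
  ~ (exists st : nat -> am_state, am_init p a g XT (st 0%N) /\
       forall j, am_step p a g XT (st j) (st j.+1)).
Proof.
move=> /find_xt_lower_bound[K lbK] [st [init step]].
have [j] := am_infinite_run_unbounded K init step; apply/negP; rewrite -leNgt.
have reached : am_reached p a g XT j (st j).
  by elim: j => [|j IHj]; [exact: AmReached0 | exact: AmReachedS (step j)].
have [_ /find_w_spec[ww _ _] _ _] := am_reached_spec reached.
by have [_ [fx _]] := step j; exact: lbK ww fx.
Qed.

Lemma am_pass_exists w K : XT !=set0 ->
  (forall z, XT z -> K <= xt_value w z.2) -> exists st, am_pass p a g XT w st.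
Proof.
move=> /find_xt_candidates[T [v [_ v_min]]] /v_min[i fx].
have [nu [w' fw]] := find_w_exists (v i).
by exists (AmState (xt_value w (v i).2) (v i) nu w').
Qed.

Lemma am_not_stuck K : XT !=set0 ->
    (forall z, XT z -> K <= range_mean p a g z.2) ->
  (exists st, am_init p a g XT st) /\
  (forall N st, am_reached p a g XT N st -> am_continue st ->
     exists st', am_step p a g XT st st').
Proof.
move=> XT0 lbK; split.
  (* A lower bound K on range means is one on tail means; the initial
     objective is (1 - a) / (g - a) times the tail mean. *)
  apply: (@am_pass_exists 0 ((g - a)^-1 * ((1 - a) * K))) => // z XTz.
  rewrite xt_value0 -tail_meanE// ler_pM2l// ler_wpM2l//.
    by case/andP: mass_a.
  exact: le_trans (lbK z XTz) (range_mean_le_tail_mean _ _ _ _ _ _).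
move=> N st /am_reached_spec[_ /find_w_spec[ww _ _] _ _] cont.
have [|st' pass] := @am_pass_exists (cur_w st) K XT0; last by exists st'.
by move=> z XTz; exact: le_trans (lbK z XTz) (range_mean_le_xt_value _ ww).
Qed.

Lemma am_stops_bounds N st : am_stops p a g XT N st ->
  let nu := nu_even st in
  let min_tail := opt_value XT (fun z => tail_mean p a z.2) in
  let nu_star := opt_value XT (fun z => range_mean p a g z.2) in
  ((0 < N)%N \/ nu_odd st = nu ->
     (nu%:E <= min_tail)%E /\ (nu_star <= nu%:E)%E) /\
  ((nu - am_eps)%:E <= min_tail)%E /\ (nu_star <= (nu + am_eps)%:E)%E.
Proof.
move=> [reached stop] nu min_tail nu_star; move: stop.
rewrite /am_continue -leNgt ler_distl => /andP[lo hi].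
have [XTx /find_w_spec[_ odd _] odd_tail later] := am_reached_spec reached.
have le_min r : (forall z, XT z -> r <= tail_mean p a z.2) ->
    (r%:E <= min_tail)%E.
  by move=> le_r; apply/ereal_infP => _ [z XTz <-]; rewrite lee_fin le_r.
have star_le r : nu_odd st <= r -> (nu_star <= r%:E)%E.
  move=> le_r; apply: ge_ereal_inf; exists (nu_odd st)%:E; rewrite ?lee_fin//.
  by exists (cur_xt st) => //; rewrite -odd.
split; last first.
  by split; [apply: le_min => z /odd_tail; exact: le_trans | exact: star_le].
move=> [/later[odd_even even_tail]|odd_even].
  by split; [exact: le_min | exact: star_le].
split; last by apply: star_le; rewrite odd_even.
by apply: le_min => z /odd_tail; rewrite odd_even.
Qed.

End Polyhedral.
End AlternatingMinimization.

(** * The alternating minimization algorithm *)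

Theorem proposition7 (R : realType) (k m n l : nat)
    (X : set 'cV[R]_k) (y : 'I_n -> 'cV[R]_m) (p : 'I_n -> R)
    (f : 'cV[R]_k -> 'cV[R]_m -> R)
    (A : 'M[R]_(l, k)) (B : 'M[R]_(l, n)) (c : 'cV[R]_l) (alpha gamma : R)
    (X_nonempty : X !=set0)
    (y_distinct : injective y)
    (p_gt0 : forall i, 0 < p i) (p_sum1 : \sum_(i < n) p i = 1)
    (f_linear : forall i, exists d : 'rV[R]_k,
       forall x, X x -> f x (y i) = (d *m x) 0 0)
    (XT_repr : forall (x : 'cV[R]_k) (t : 'cV[R]_n),
       (X x /\ forall i, t i 0 = f x (y i)) <-> polyhedron A B c (x, t))
    (XT_nonempty : polyhedron A B c !=set0)
    (XT_closed : closed (polyhedron A B c))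
    (XT_convex : forall (z z' : 'cV[R]_k * 'cV[R]_n) (r : R),
       polyhedron A B c z -> polyhedron A B c z' -> 0 <= r <= 1 ->
       polyhedron A B c (r *: z + (1 - r) *: z'))
    (alpha_ge0 : 0 <= alpha) (alpha_lt_gamma : alpha < gamma)
    (gamma_le1 : gamma <= 1) :
  let XT := polyhedron A B c in
  let min_tail := opt_value XT (fun z => tail_mean p alpha z.2) in
  let nu_star := opt_value XT (fun z => range_mean p alpha gamma z.2) in
  [/\ (* no execution runs the loop forever *)
      ~ (exists st : nat -> am_state,
           am_init p alpha gamma XT (st 0%N) /\
           forall j, am_step p alpha gamma XT (st j) (st j.+1)),
      (* no execution is stuck in a subroutine, provided nu_star is finite *)
      (-oo < nu_star)%E ->
        (exists st, am_init p alpha gamma XT st) /\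
        (forall N st, am_reached p alpha gamma XT N st -> am_continue st ->
           exists st', am_step p alpha gamma XT st st')
    & (* the returned value: exact bounds once the loop body has run or if the
         first test holds with equality; otherwise (0 < |nu_1 - nu_0| <= eps
         at the first test) the exact bounds can fail, by at most eps *)
      forall N st, am_stops p alpha gamma XT N st ->
        let nu := nu_even st in
        ((0 < N)%N \/ nu_odd st = nu ->
           (nu%:E <= min_tail)%E /\ (nu_star <= nu%:E)%E) /\
        ((nu - am_eps)%:E <= min_tail)%E /\
        (nu_star <= (nu + am_eps)%:E)%E ].
Proof.
split.
- exact: am_terminates.
- move=> nu_star_fin.
  have [z0 XTz0] := XT_nonempty.
  have star_le z : polyhedron A B c z ->
      (opt_value (polyhedron A B c) (fun z => range_mean p alpha gamma z.2) <=
       (range_mean p alpha gamma z.2)%:E)%E.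
    move=> XTz; apply: ge_ereal_inf.
    by exists (range_mean p alpha gamma z.2)%:E => //; exists z.
  move: nu_star_fin star_le; case: opt_value => [K| |] // _ star_le.
    by apply: (@am_not_stuck _ _ _ _ _ _ _ _ _ _ _ _ _ _ _ K) => // z /star_le;
      rewrite lee_fin.
  by have := star_le z0 XTz0; rewrite leye_eq.
- by move=> N st; exact: am_stops_bounds.
Qed.
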